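(* Let $\alpha,\beta$ be positive real numbers whose BCF expansion is infinite. Then the BCF expansion $(\{a_0,a_1,\ldots,a_i,\ldots\},\{b_0,b_1,\ldots,b_i,\ldots\})$ of the ordered pair $(\alpha,\beta)$ is a Fibonacci Tree representation of $(\alpha,\beta)$.
   Context: BCF expansion: for positive reals $\alpha,\beta$, put $\alpha_0=\alpha$, $\beta_0=\beta$ and, for $i\ge 0$, $a_i=\lfloor\alpha_i\rfloor$, $b_i=\lfloor\beta_i\rfloor$, $\alpha_{i+1}=1/(\beta_i-b_i)$, $\beta_{i+1}=(\alpha_i-a_i)/(\beta_i-b_i)$. The algorithm stops at the first $n$ for which $\beta_n$ is an integer (the expansion is then called finite); if no $\beta_n$ is an integer, the expansion is infinite and is the ordered pair of sequences $(\{a_i\}_{i\ge 0},\{b_i\}_{i\ge 0})$. Fibonacci Tree sum: the ordered pair of real numbers $[\{a_0,\ldots,a_{n-1},x\},\{b_0,\ldots,b_{n-1},y\}]$ is defined recursively by $[\{x\},\{y\}]=(x,y)$ and, for $n\ge 1$, $[\{a_0,\ldots,a_{n-1},x\},\{b_0,\ldots,b_{n-1},y\}]=[\{a_0,\ldots,a_{n-2},a_{n-1}+y/x\},\{b_0,\ldots,b_{n-2},b_{n-1}+1/x\}]$. Fibonacci Tree representation: an ordered pair of (infinite) non-negative integer sequences $(\{a_i\}_{i\ge0},\{b_i\}_{i\ge0})$ is a Fibonacci Tree representation of $(\alpha,\beta)$ if the $n$-term Fibonacci Tree sums $(\alpha^{(n)},\beta^{(n)})=[\{a_0,\ldots,a_n\},\{b_0,\ldots,b_n\}]$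 satisfy $\lim_{n\to\infty}(\alpha^{(n)},\beta^{(n)})=(\alpha,\beta)$. *)

(* Defs.v *)
From HB Require Import structures.
From mathcomp Require Import all_boot all_order all_algebra.
From mathcomp Require Import all_classical all_reals all_analysis.

Set Implicit Arguments.
Unset Strict Implicit.
Unset Printing Implicit Defensive.

Import Order.TTheory GRing.Theory Num.Theory.
Import numFieldNormedType.Exports.

Local Open Scope classical_set_scope.
Local Open Scope ring_scope.

(* The pair (alpha_n, beta_n).  Division is total (x / 0 = 0), so the values
   are meaningful only as long as no earlier beta_i is an integer, i.e. as long
   as the algorithm has not stopped. *)
Fixpoint bcf_pair (R : realType) (alpha beta : R) (n : nat) : R * R :=
  if n is m.+1 then
    let: (x, y) := bcf_pair alpha beta m in
    (1 / (y - (Num.floor y)%:~R),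
     (x - (Num.floor x)%:~R) / (y - (Num.floor y)%:~R))
  else (alpha, beta).

Definition bcf_a (R : realType) (alpha beta : R) (n : nat) : int :=
  Num.floor (bcf_pair alpha beta n).1.

Definition bcf_b (R : realType) (alpha beta : R) (n : nat) : int :=
  Num.floor (bcf_pair alpha beta n).2.

Definition bcf_infinite (R : realType) (alpha beta : R) : Prop :=
  forall n : nat, (bcf_pair alpha beta n).2 \isn't a Num.int.

(* [ft_sum a b n x y] is
   [{a_0, ..., a_(n-1), x}, {b_0, ..., b_(n-1), y}]. *)
Fixpoint ft_sum (R : realType) (a b : nat -> int) (n : nat) (x y : R) : R * R :=
  if n is m.+1 then ft_sum a b m ((a m)%:~R + y / x) ((b m)%:~R + 1 / x)
  else (x, y).

(* No division by zero occurs in the evaluation of [ft_sum a b n x y]. *)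
Fixpoint ft_sum_defined (R : realType) (a b : nat -> int) (n : nat) (x y : R) :
    bool :=
  if n is m.+1 then
    (x != 0) && ft_sum_defined a b m ((a m)%:~R + y / x) ((b m)%:~R + 1 / x)
  else true.

(* [{a_0, ..., a_n}, {b_0, ..., b_n}] *)
Definition ft_partial (R : realType) (a b : nat -> int) (n : nat) : R * R :=
  ft_sum a b n (a n)%:~R (b n)%:~R.

Definition ft_representation (R : realType) (a b : nat -> int)
    (alpha beta : R) : Prop :=
  [/\ forall i : nat, 0 <= a i /\ 0 <= b i,
      forall n : nat, ft_sum_defined a b n ((a n)%:~R : R) (b n)%:~R
    & (ft_partial R a b n @[n --> \oo] --> (alpha, beta))].

(* Main.v *)
Require Import Defs.
From HB Require Import structures.
From mathcomp Require Import all_boot all_order all_algebra.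
From mathcomp Require Import all_classical all_reals all_analysis.
From mathcomp Require Import ring lra.

Import Order.TTheory GRing.Theory Num.Theory.
Import numFieldNormedType.Exports.

Local Open Scope ring_scope.

(** The [n]-th Fibonacci Tree sum is [(p_n / r_n, q_n / r_n)], where [p], [q] and
    [r] all satisfy the recurrence [s_n = a_n s_(n-1) + b_n s_(n-2) + s_(n-3)].
    Hence [p_n / r_n] is a weighted mean of its three predecessors, and the bound
    [b_n <= a_n] gives the weight of the immediate predecessor at least [1 / 3].
    This makes the range of three consecutive values shrink by a factor [8 / 9]
    every two steps.  Since [(alpha, beta)] is the sum whose tail is the exact
    pair [(alpha_n, beta_n)], [alpha] is itself a positively weighted mean of
    three consecutive values, so it is squeezed together with them (and likewise
    [beta], with [q] in place of [p]). *)

(** * Convergence of sequences whose three-term windows contract *)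

Section Contraction.
Local Open Scope classical_set_scope.
Local Open Scope ring_scope.
Context {R : realType}.

Definition within (m M : R) (u : nat -> R) (n : nat) : Prop :=
  [/\ m <= u n <= M, m <= u n.+1 <= M & m <= u n.+2 <= M].

Lemma window_contraction (u : nat -> R) :
    (forall m M n, within m M u n ->
       m + (u n.+2 - m) / 3 <= u n.+3 <= M - (M - u n.+2) / 3) ->
  exists C, forall k, exists m M,
    M - m = (8 / 9) ^+ k * C /\ forall n, (k.*2 <= n)%N -> within m M u n.
Proof.
move=> step.
have extend m M n : within m M u n -> forall i, within m M u (n + i).
  move=> wn; elim=> [|i IHi]; first by rewrite addn0.
  have := step _ _ _ IHi; case: IHi => _ h1 h2 h3.
  by rewrite addnS; split=> //; lra.
set C := `|u 0%N| + `|u 1%N| + `|u 2%N|; exists (C - - C).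
elim=> [|k [m [M [mM wmM]]]].
  exists (- C), C; split=> [|n _]; first by rewrite expr0 mul1r.
  rewrite -(add0n n); apply: extend; rewrite /within -!ler_norml /C.
  have := normr_ge0 (u 0%N); have := normr_ge0 (u 1%N).
  have := normr_ge0 (u 2%N).
  by split; lra.
have [_ _ h2] := wmM _ (leqnn k.*2).
have h3 := step _ _ _ (wmM _ (leqnn k.*2)).
have h4 := step _ _ _ (wmM _ (leqnSn k.*2)).
(* Each value keeps a third of its predecessor's distance to either end, so two steps keep a ninth
   of the distance of [u k.*2.+2]. Wherever that value lies, the two cuts add up to
   [(M - m) / 9]. *)
exists (m + (u k.*2.+2 - m) / 9), (M - (M - u k.*2.+2) / 9); split.
  by rewrite exprS -mulrA -mM; lra.
move=> n; rewrite doubleS => kn; rewrite -(subnKC kn); apply: extend.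
by split; lra.
Qed.

Lemma cvg_window_contraction (u : nat -> R) (t : R) :
    (forall m M n, within m M u n ->
       m + (u n.+2 - m) / 3 <= u n.+3 <= M - (M - u n.+2) / 3) ->
    (forall m M n, within m M u n -> m <= t <= M) ->
  u n @[n --> \oo] --> t.
Proof.
move=> step mean; apply/cvgrPdist_le => e e0.
have [C wc] := window_contraction u step.
have : (8 / 9 : R) ^+ k * C @[k --> \oo] --> 0.
  rewrite -(mul0r C); apply: cvgM; last exact: cvg_cst.
  by apply: cvg_expr; rewrite ger0_norm; lra.
move=> /cvgrPdist_le /(_ e e0)[k _ /(_ k (leqnn k))] /=.
have [m [M [mM wmM]]] := wc k; rewrite -mM sub0r normrN => /ler_normlP[_ mMe].
exists k.*2 => // n /= kn.
have wn := wmM _ kn; have := mean _ _ _ wn; case: wn => h _ _ h'.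
by rewrite ler_norml; lra.
Qed.

Lemma cvg_ratio_recurrence (a b r p : nat -> R) (t : R) :
    (forall n, r n.+3 = a n * r n.+2 + b n * r n.+1 + r n) ->
    (forall n, p n.+3 = a n * p n.+2 + b n * p n.+1 + p n) ->
    (forall n, 1 <= a n) -> (forall n, 0 <= b n <= a n) ->
    0 < r 0%N -> r 0%N <= r 1%N -> r 1%N <= r 2%N ->
    (forall n, exists x y, [/\ 0 <= x, 0 <= y &
       t * (x * r n.+2 + y * r n.+1 + r n) = x * p n.+2 + y * p n.+1 + p n]) ->
  p n / r n @[n --> \oo] --> t.
Proof.
move=> rS pS a1 ba r0 r01 r12 tmean.
have rP n : [/\ 0 < r n, r n <= r n.+1 & r n.+1 <= r n.+2].
  elim: n => [//|n [rn rn1 rn2]]; split => //; first by lra.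
  by rewrite rS; have := a1 n; have := ba n; nra.
have bound m M n : m <= p n / r n <= M -> m * r n <= p n <= M * r n.
  by have [rn _ _] := rP n; rewrite ler_pdivlMr// ler_pdivrMr.
apply: cvg_window_contraction => m M n [/bound h0 /bound h1 h2'];
  have h2 := bound _ _ _ h2'; have [rn rn1 rn2] := rP n.
- have r3 : 0 < r n.+3 by have [] := rP n.+3.
  have pE : p n.+2 = p n.+2 / r n.+2 * r n.+2 by rewrite divfK//; lra.
  set v := p n.+2 / r n.+2 in h2' pE *.
  have an := a1 n; have bn := ba n.
  (* Each of the three terms of [r n.+3] is at most [a n * r n.+2]. *)
  have le3 : r n.+3 <= 3 * (a n * r n.+2) by rewrite rS; nra.
  rewrite ler_pdivlMr// ler_pdivrMr// pS.
  apply/andP; split.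
    have : (v - m) * r n.+3 <= (v - m) * (3 * (a n * r n.+2)).
      by apply: ler_wpM2l => //; lra.
    have : b n * (m * r n.+1) <= b n * p n.+1 by apply: ler_wpM2l; lra.
    by have := rS n; rewrite pE; nra.
  have : (M - v) * r n.+3 <= (M - v) * (3 * (a n * r n.+2)).
    by apply: ler_wpM2l => //; lra.
  have : b n * p n.+1 <= b n * (M * r n.+1) by apply: ler_wpM2l; lra.
  by have := rS n; rewrite pE; nra.
- have [x [y [x0 y0 tE]]] := tmean n.
  have d0 : 0 < x * r n.+2 + y * r n.+1 + r n.
    by rewrite ltr_wpDl// addr_ge0// mulr_ge0//; lra.
  rewrite -(ler_pM2r d0) -[t <= M](ler_pM2r d0) tE.
  case/andP: h0 => h00 h01; case/andP: h1 => h10 h11; case/andP: h2 => h20 h21.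
  have := ler_wpM2l y0 h10; have := ler_wpM2l y0 h11.
  have := ler_wpM2l x0 h20; have := ler_wpM2l x0 h21.
  by move=> *; apply/andP; split; lra.
Qed.

End Contraction.

(** * Numerators and denominators of Fibonacci Tree sums *)

Section Convergents.
Context {R : realType} (a b : nat -> int).

(* The index is shifted by three: [convergent x y z n] is the term
   [s_(n-3)], and [x], [y], [z] are the terms of index -3, -2, -1. *)
Fixpoint convergent (x y z : R) (n : nat) : R :=
  match n with
  | 0 => x
  | 1 => y
  | 2 => z
  | (((m.+1) as m1).+1 as m2).+1 =>
      (a m)%:~R * convergent x y z m2 + (b m)%:~R * convergent x y z m1
      + convergent x y z m
  end.

Lemma convergentS x y z n :
  convergent x y z n.+3 =
    (a n)%:~R * convergent x y z n.+2 + (b n)%:~R * convergent x y z n.+1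
    + convergent x y z n.
Proof. by []. Qed.

Local Notation p := (convergent 0 0 1).
Local Notation q := (convergent 0 1 0).
Local Notation r := (convergent 1 0 0).
Local Notation comb s n x y := (x * s n.+2 + y * s n.+1 + s n).

(** [comb s n x y] is the recurrence for [s n.+3] with [x], [y] in place of [a n], [b n]. One
    folding step divides it by [x] for each of [p], [q] and [r], so the quotients are unchanged. *)
Lemma ft_sum_convergent n (x y : R) : ft_sum_defined a b n x y ->
  ft_sum a b n x y = (comb p n x y / comb r n x y, comb q n x y / comb r n x y).
Proof.
elim: n x y => [|n IHn] x y.
  by move=> _ /=; rewrite !mulr0 !mulr1 !addr0 !add0r !divr1.
move=> /andP[x0 /IHn IH]; rewrite [LHS]IH.
have scale s : comb (convergent s.1.1 s.1.2 s.2) n.+1 x y =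
    x * comb (convergent s.1.1 s.1.2 s.2) n ((a n)%:~R + y / x)
                                          ((b n)%:~R + 1 / x).
  by rewrite convergentS; field.
rewrite (scale (0, 0, 1)) (scale (0, 1, 0)) (scale (1, 0, 0)).
by rewrite -!(mulf_div x) divff// !mul1r.
Qed.

Lemma ft_partial_convergent n :
  ft_sum_defined a b n ((a n)%:~R : R) (b n)%:~R ->
  ft_partial R a b n = (p n.+3 / r n.+3, q n.+3 / r n.+3).
Proof. exact: ft_sum_convergent. Qed.

(** The guard [0 < n] leaves room for a zero first entry, as [a 0] is when [alpha < 1]; nothing is
    divided by that entry. *)
Lemma ft_sum_defined_gt0 n (x y : R) :
    (forall i, 1 <= a i.+1) -> (forall i, 0 <= b i) ->
    ((0 < n)%N -> 0 < x) -> 0 <= y ->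
  ft_sum_defined a b n x y.
Proof.
move=> a1 b0; elim: n x y => [//|n IHn] x y /(_ isT) x0 y0 /=.
rewrite gt_eqF//=; apply: IHn.
  case: n => // n _; apply: ltr_wpDr; first by rewrite divr_ge0// ltW.
  by rewrite ltr0z; apply: lt_le_trans (a1 n).
by rewrite addr_ge0// ?ler0z// divr_ge0// ltW.
Qed.

End Convergents.

Lemma floor_frac {R : realType} (z : R) : z \isn't a Num.int ->
  0 < z - (Num.floor z)%:~R < 1.
Proof.
rewrite intrEfloor => zE; have /andP[lez ltz] := floor_itv z.
by rewrite subr_gt0 lt_neqAle zE lez ltrBlDl -intrD1.
Qed.

(** * Digits and tails of the BCF expansion *)

Section BCF.
Context {R : realType} {alpha beta : R}.
Hypotheses (alpha_gt0 : 0 < alpha) (beta_gt0 : 0 < beta).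
Hypothesis infinite : bcf_infinite alpha beta.

Local Notation x n := (bcf_pair alpha beta n).1.
Local Notation y n := (bcf_pair alpha beta n).2.
Local Notation a := (bcf_a alpha beta).
Local Notation b := (bcf_b alpha beta).

Lemma bcf_pairS1 n : x n.+1 = 1 / (y n - (b n)%:~R).
Proof. by rewrite /bcf_b /=; case: bcf_pair. Qed.

Lemma bcf_pairS2 n : y n.+1 = (x n - (a n)%:~R) / (y n - (b n)%:~R).
Proof. by rewrite /bcf_a /bcf_b /=; case: bcf_pair. Qed.

Lemma bcf_b_frac n : 0 < y n - (b n)%:~R < 1.
Proof. exact/floor_frac/infinite. Qed.

(* An integer [alpha_n] would make [beta_(n+1)] the integer 0. *)
Lemma bcf_a_frac n : 0 < x n - (a n)%:~R < 1.
Proof.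
apply: floor_frac; apply: contra (infinite n.+1).
rewrite bcf_pairS2 intrEfloor => /eqP xE.
by rewrite /bcf_a xE subrr mul0r int_num0.
Qed.

Lemma bcf_pair_gt0 n : 0 < x n /\ 0 < y n.
Proof.
case: n => [//|n]; rewrite bcf_pairS1 bcf_pairS2.
have /andP[? _] := bcf_a_frac n; have /andP[? _] := bcf_b_frac n.
by split; rewrite divr_gt0.
Qed.

Lemma bcf_a_ge0 n : 0 <= a n.
Proof. by rewrite floor_ge0 ltW//; have [] := bcf_pair_gt0 n. Qed.

Lemma bcf_b_ge0 n : 0 <= b n.
Proof. by rewrite floor_ge0 ltW//; have [] := bcf_pair_gt0 n. Qed.

Lemma bcf_aS_ge1 n : 1 <= a n.+1.
Proof.
rewrite floor_ge_int bcf_pairS1; have /andP[? ?] := bcf_b_frac n.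
by rewrite ler_pdivlMr// mul1r ltW.
Qed.

(** Over the common denominator [y n - b n], [x n.+1] has numerator 1 and [y n.+1] has a fractional
    part. Index 0 is excluded, since [alpha] and [beta] are not related. *)
Lemma bcf_bS_le_aS n : b n.+1 <= a n.+1.
Proof.
apply: le_floor; rewrite bcf_pairS1 bcf_pairS2.
have /andP[? _] := bcf_b_frac n; have /andP[_ ?] := bcf_a_frac n.
by rewrite ler_pM2r ?invr_gt0// ltW.
Qed.

(** Folding the tail once is the inverse of one BCF step. *)
Lemma ft_sum_bcf_pair n : ft_sum a b n (x n) (y n) = (alpha, beta).
Proof.
elim: n => [//|n <-] /=.
(* Simplification has unfolded the pair of index [n.+1]; the patterns fold it back. *)
have /andP[? _] := bcf_b_frac n; rewrite -[X in (_ + X / _)]/(y n.+1).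
rewrite -[X in (_ + _ / X)]/(x n.+1) -[X in (_ + 1 / X)]/(x n.+1).
by congr ft_sum; rewrite bcf_pairS1 ?bcf_pairS2; field; rewrite gt_eqF.
Qed.

Lemma ft_sum_defined_bcf n (z w : R) :
  ((0 < n)%N -> 0 < z) -> 0 <= w -> ft_sum_defined a b n z w.
Proof. exact: ft_sum_defined_gt0 bcf_aS_ge1 bcf_b_ge0. Qed.

Lemma ft_sum_defined_partial n :
  ft_sum_defined a b n ((a n)%:~R : R) (b n)%:~R.
Proof.
apply: ft_sum_defined_bcf; last by rewrite ler0z bcf_b_ge0.
by case: n => // n _; rewrite ltr0z (lt_le_trans _ (bcf_aS_ge1 n)).
Qed.

Local Notation p := (convergent a b (0 : R) 0 1).
Local Notation q := (convergent a b (0 : R) 1 0).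
Local Notation r := (convergent a b (1 : R) 0 0).
Local Notation comb s n := (x n * s n.+2 + y n * s n.+1 + s n).

(** The seeds 1, 0, 0 are not monotone; from index 3 on, the values are 1, [a 1], [a 2 * a 1 + b 2]
    and so on. *)
Lemma convergent_gt0 n :
  [/\ 0 < r n.+3, r n.+3 <= r n.+4 & r n.+4 <= r n.+1.+4].
Proof.
elim: n => [|n [r3 r34 r45]].
  rewrite !convergentS /=; have : (1 : R) <= (a 1)%:~R by rewrite ler1z bcf_aS_ge1.
  have : (1 : R) <= (a 2)%:~R by rewrite ler1z bcf_aS_ge1.
  have : (0 : R) <= (b 2)%:~R by rewrite ler0z bcf_b_ge0.
  by split; nra.
split=> //; first exact: lt_le_trans r34.
rewrite [leRHS]convergentS.
have : (1 : R) <= (a n.+3)%:~R by rewrite ler1z bcf_aS_ge1.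
have : (0 : R) <= (b n.+3)%:~R by rewrite ler0z bcf_b_ge0.
by nra.
Qed.

(** The quotient formula for sums, applied to the exact tail and cleared of denominators. *)
Lemma bcf_pair_mean n :
  alpha * comb r n.+3 = comb p n.+3 /\ beta * comb r n.+3 = comb q n.+3.
Proof.
have [x0 y0] := bcf_pair_gt0 n.+3.
have [r3 r34 r45] := convergent_gt0 n.
have d0 : comb r n.+3 != 0.
  by rewrite gt_eqF// ltr_wpDl// addr_ge0// mulr_ge0//; lra.
have mulE (z t : R) : z / comb r n.+3 = t -> t * comb r n.+3 = z.
  by move=> <-; rewrite divfK.
have := ft_sum_bcf_pair n.+3; rewrite ft_sum_convergent.
  by move=> [/mulE ? /mulE ?].
exact: ft_sum_defined_bcf (fun=> x0) (ltW y0).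
Qed.

Lemma cvg_convergent (s0 s1 s2 t : R) (s := convergent a b s0 s1 s2) :
    (forall n, t * comb r n.+3 = comb s n.+3) ->
  (s n.+3 / r n.+3 @[n --> \oo] --> t)%classic.
Proof.
move=> mean; have [r3 r34 r45] := convergent_gt0 0.
(* The shift by three skips the seeds, and gives the coefficients positive indices, where the digit
   bounds hold. *)
apply: (cvg_ratio_recurrence (fun n => (a n.+3)%:~R) (fun n => (b n.+3)%:~R)
  (fun n => r n.+3) (fun n => s n.+3)) => // n.
- by rewrite ler1z bcf_aS_ge1.
- by rewrite ler0z ler_int bcf_b_ge0 bcf_bS_le_aS.
- exists (x n.+3), (y n.+3); have [x0 y0] := bcf_pair_gt0 n.+3.
  by split; [exact: ltW|exact: ltW|exact: mean].
Qed.

End BCF.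

Theorem theorem1 (R : realType) (alpha beta : R)
    (halpha : 0 < alpha) (hbeta : 0 < beta)
    (hinf : bcf_infinite alpha beta) :
  ft_representation (bcf_a alpha beta) (bcf_b alpha beta) alpha beta.
Proof.
split=> [i|n|].
- by split; [exact: bcf_a_ge0|exact: bcf_b_ge0].
- exact: ft_sum_defined_partial.
under eq_fun => n do
  rewrite (ft_partial_convergent _ _ _ (ft_sum_defined_partial halpha hbeta hinf n)).
have mean n := bcf_pair_mean halpha hbeta hinf n.
have cvg_p := cvg_convergent halpha hbeta hinf 0 0 1 _ (fun n => proj1 (mean n)).
have cvg_q := cvg_convergent halpha hbeta hinf 0 1 0 _ (fun n => proj2 (mean n)).
exact: cvg_pair cvg_p cvg_q.
Qed.
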